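(* For any dimension $d\ge 3$, there exists a constant $c\in(0,\infty)$ such that $\theta(u)=0$ for all $u\ge c$.
   Context: $\mathbb L$ is the set of lines in $\mathbb R^d$; $\mu=\gamma(\lambda\otimes\nu)$ with $\lambda$ Lebesgue measure on $e_1^\perp$, $\nu$ Haar probability on $SO_d$, $\gamma(x,\vartheta)=\vartheta(x+\mathbb R e_1)$ (the translation- and rotation-invariant measure on lines). $\mathbb P_u$ is the law of a Poisson point process $\omega$ on $\mathbb L$ with intensity $u\mu$, $u>0$. Each line $l$ in the support gives the closed cylinder $C(l)=l+\overline{B(0,1)}$; $\mathcal L=\bigcup_{l\in\operatorname{supp}\omega}C(l)$, vacant set $\mathcal V=\mathbb R^d\setminus\mathcal L$. $\theta(u)=\mathbb P_u[0\leftrightarrow\infty]$, where $\{0\leftrightarrow\infty\}$ is the event that for every $n\ge1$ there is a continuous path in $\mathcal V$ from $0$ to $\partial B(0,n)$. *)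

(* Defs.v *)
From HB Require Import structures.
From mathcomp Require Import all_boot all_order all_algebra.
From mathcomp Require Import all_classical all_reals all_analysis.
Unset Printing Implicit Defensive.
Import Order.TTheory GRing.Theory Num.Theory.
Import numFieldNormedType.Exports.
Local Open Scope classical_set_scope.
Local Open Scope ring_scope.

(* Euclidean norm (the library norm on 'rV is the max-norm). *)
Definition enorm {R : realType} {d : nat} (x : 'rV[R]_d) : R :=
  Num.sqrt (\sum_(i < d) x ord0 i ^+ 2).

Definition e1 {R : realType} {d : nat} : 'rV[R]_d :=
  \row_(i < d) (if val i == 0%N then 1 else 0).

Definition e1perp {R : realType} (d : nat) : set 'rV[R]_d :=
  [set x | forall i : 'I_d, val i = 0%N -> x ord0 i = 0].

Definition SO {R : realType} (d : nat) : set 'M[R]_d :=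
  [set th | th *m th^T = 1%:M /\ \det th = 1].

Definition borel (T : topologicalType) : set (set T) :=
  smallest (sigma_algebra setT) open.
Arguments borel : clear implicits.

Definition is_measure {R : realType} {T : Type} (S : set (set T))
    (mu : set T -> \bar R) : Prop :=
  [/\ mu set0 = 0%E,
      (forall A, S A -> (0 <= mu A)%E) &
      (forall F : nat -> set T, (forall n, S (F n)) -> trivIset setT F ->
         (fun n => \sum_(0 <= i < n) mu (F i))%E @ \oo --> mu (\bigcup_n F n))].

(* nu is the Haar probability measure on SO_d (a Borel probability measure
   on matrices carried by SO_d and invariant under left translations by
   SO_d; it is unique). *)
Definition is_haar_SO {R : realType} (d : nat) (nu : set 'M[R]_d -> \bar R)
  : Prop :=
  [/\ is_measure (borel 'M[R]_d) nu,
      nu (~` SO d) = 0%E,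
      nu setT = 1%E &
      (forall g B, SO d g -> borel 'M[R]_d B ->
         nu [set g *m X | X in B] = nu B)].

Definition hbox {R : realType} {d : nat} (a b : 'rV[R]_d) : set 'rV[R]_d :=
  [set x | forall i : 'I_d, if val i == 0%N then x ord0 i = 0
                            else a ord0 i <= x ord0 i <= b ord0 i].

Definition hvol {R : realType} {d : nat} (a b : 'rV[R]_d) : R :=
  \prod_(i < d | val i != 0%N) (b ord0 i - a ord0 i).

(* kappa = lambda (x) nu, where lambda is the (d-1)-dimensional Lebesgue
   measure on e_1^perp and nu the Haar probability on SO_d; kappa is a Borel
   measure on R^d x M_d(R) (it is uniquely determined by these properties). *)
Definition is_leb_haar_product {R : realType} (d : nat)
    (nu : set 'M[R]_d -> \bar R)
    (kappa : set ('rV[R]_d * 'M[R]_d) -> \bar R) : Prop :=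
  [/\ is_measure (borel ('rV[R]_d * 'M[R]_d)%type) kappa,
      kappa (~` (e1perp d `*` SO d)) = 0%E &
      (forall (a b : 'rV[R]_d) B, (forall i, a ord0 i <= b ord0 i) ->
         borel 'M[R]_d B ->
         kappa (hbox a b `*` B) = ((hvol a b)%:E * nu B)%E)].

(* gamma(x, theta) = theta (x + R e_1), as a subset of R^d
   (theta acts on column vectors, i.e. on rows by  p |-> p *m theta^T). *)
Definition gamma {R : realType} {d : nat} (z : 'rV[R]_d * 'M[R]_d)
  : set 'rV[R]_d :=
  [set (z.1 + t *: e1) *m z.2^T | t in [set: R]].

Definition line_measurable {R : realType} {d : nat}
    (A : set (set 'rV[R]_d)) : Prop :=
  borel ('rV[R]_d * 'M[R]_d)%type (gamma @^-1` A).

Definition line_measure {R : realType} {d : nat}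
    (kappa : set ('rV[R]_d * 'M[R]_d) -> \bar R)
    (A : set (set 'rV[R]_d)) : \bar R :=
  kappa (gamma @^-1` A).

Definition count_pts {L : choiceType} {R : realType} (om : L -> nat) (A : set L)
  : \bar R :=
  \esum_(l in A) ((om l)%:R)%:E.

Definition pois_pmf {R : realType} (r : R) (k : nat) : R :=
  expR (- r) * r ^+ k / (k`!)%:R.

Definition is_poisson_pp {R : realType} {dO : measure_display}
    {Omega : measurableType dO} (P : probability Omega R) {L : choiceType}
    (om : Omega -> L -> nat) (S : set (set L)) (m : set L -> \bar R) : Prop :=
  forall (n : nat) (A : 'I_n -> set L) (k : 'I_n -> nat),
    (forall i, S (A i)) -> (forall i, (m (A i) < +oo)%E) ->
    (forall i j, i != j -> A i `&` A j = set0) ->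
    measurable [set w | forall i, count_pts (R:=R) (om w) (A i) = ((k i)%:R)%:E] /\
    P [set w | forall i, count_pts (R:=R) (om w) (A i) = ((k i)%:R)%:E]
      = (\prod_(i < n) pois_pmf (fine (m (A i))) (k i))%:E.

Definition cylinder {R : realType} {d : nat} (l : set 'rV[R]_d)
  : set 'rV[R]_d :=
  [set p | exists q, l q /\ enorm (p - q) <= 1].

Definition vacant {R : realType} {d : nat} (om : set 'rV[R]_d -> nat)
  : set 'rV[R]_d :=
  ~` \bigcup_(l in [set l | (0 < om l)%N]) cylinder l.

Definition connects_to_infinity {R : realType} {d : nat}
    (V : set 'rV[R]_d) : Prop :=
  forall n : nat, (1 <= n)%N ->
    exists f : R -> 'rV[R]_d,
      [/\ {within [set t | 0 <= t <= 1], continuous f},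
          f 0 = 0, enorm (f 1) = n%:R &
          (forall t, 0 <= t <= 1 -> V (f t))].

(* Main.v *)
(* Multiscale union bound over binary trees, after Rath's argument for random
   interlacements.  A path crossing the annulus of radii [L_n] and [2 L_n] around
   [x], with [L_n = r B^n], crosses two annuli of level [n-1] whose centres lie in
   a fixed finite set of translates of [x] and are at distance at least
   [L_n - 2 L_(n-1)].  Iterating yields [2^n] balls of radius 1/2 meeting the path;
   if the path is vacant, no line of the process hits any of them, because a
   cylinder whose axis hits such a ball contains the points of the path near its
   centre.  There are at most [C^(2^n)] such families of balls.  The measure of the
   lines hitting two given balls at distance [D] is [O(1/D)]: this is a bound on
   the Haar measure of a set of directions, about [D] rotates of which are
   disjoint.  So for [B] large the lines hitting a family have measure at least
   [c 2^n], and the union bound [C^(2^n) exp(-c u 2^n)] tends to zero for [u]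
   large. *)
Require Import Defs.
From HB Require Import structures.
From mathcomp Require Import all_boot all_order all_algebra.
From mathcomp Require Import all_classical all_reals all_analysis.
From mathcomp Require Import ring lra zify.
Import Order.TTheory GRing.Theory Num.Theory.
Import numFieldNormedType.Exports.
Local Open Scope classical_set_scope.
Local Open Scope ring_scope.

(** * Borel sets and measures *)

Section measure_of_is_measure.
Context {R : realType} {T : pointedType} (G : set (set T)) (mu : set T -> \bar R).
Hypothesis mu_measure : is_measure (<<s G >>) mu.

(* [is_measure] says nothing about sets outside [<<s G >>], where the library
   still requires a measure to be nonnegative. *)
Let m (A : set (g_sigma_algebraType G)) : \bar R :=
  if `[< <<s G >> A >] then mu A else 0%E.

Let m0 : m set0 = 0%E.
Proof. by case: mu_measure => mu0 _ _; rewrite /m mu0 if_same. Qed.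

Let m_ge0 A : (0 <= m A)%E.
Proof.
by rewrite /m; case: ifPn => // /asboolP GA; case: mu_measure => _ + _; exact.
Qed.

Let m_sigma_additive : semi_sigma_additive m.
Proof.
move=> F mF tF mUF; case: mu_measure => _ _ /(_ F mF tF).
rewrite /m; case: asboolP => // _.
suff -> : (fun n => \sum_(0 <= i < n) mu (F i))%E =
  (fun n => \sum_(0 <= i < n) if `[< <<s G >> (F i) >] then mu (F i) else 0)%E by [].
by apply/funext => n; apply: eq_bigr => i _; case: asboolP => // /(_ (mF i)).
Qed.

HB.instance Definition _ :=
  isMeasure.Build _ (g_sigma_algebraType G) R m m0 m_ge0 m_sigma_additive.

(** Passing to a bundled measure gives access to monotonicity, subadditivity and
    inclusion-exclusion. *)
Lemma measure_of_is_measure :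
  exists m : {measure set (g_sigma_algebraType G) -> \bar R},
    forall A, <<s G >> A -> m A = mu A.
Proof.
by exists m => A GA /=; rewrite /m; case: asboolP.
Qed.

End measure_of_is_measure.

Section borel_sets.
Context {T : topologicalType}.
Implicit Types A B : set T.

Lemma borel_open A : open A -> borel T A.
Proof. exact: sub_sigma_algebra. Qed.

Lemma borelC A : borel T A -> borel T (~` A).
Proof.
by rewrite -setTD; have [_ + _] := smallest_sigma_algebra setT (@open T); exact.
Qed.

Lemma borel_bigcup (A : nat -> set T) :
  (forall i, borel T (A i)) -> borel T (\bigcup_i A i).
Proof. by have [_ _ +] := smallest_sigma_algebra setT (@open T); exact. Qed.

Lemma borel_closed A : closed A -> borel T A.
Proof. by move=> cA; rewrite -(setCK A); apply: borelC; apply: borel_open; rewrite openC. Qed.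

Lemma borelT : borel T setT.
Proof. by apply: borel_open; exact: openT. Qed.

Lemma borel0 : borel T set0.
Proof. by apply: borel_open; exact: open0. Qed.

Lemma borelU A B : borel T A -> borel T B -> borel T (A `|` B).
Proof.
by move=> bA bB; rewrite -bigcup2E; apply: borel_bigcup => -[|[|i]]//=; exact: borel0.
Qed.

Lemma borelI A B : borel T A -> borel T B -> borel T (A `&` B).
Proof.
move=> bA bB; rewrite -(setCK (A `&` B)) setCI.
by apply: borelC; apply: borelU; exact: borelC.
Qed.

Lemma borel_bigU {I : Type} (r : seq I) (A : I -> set T) :
  (forall i, borel T (A i)) -> borel T (\big[setU/set0]_(i <- r) A i).
Proof.
by move=> bA; elim/big_ind : _ => //; [exact: borel0|exact: borelU].
Qed.

Lemma borel_forall (J : finType) (A : J -> set T) :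
  (forall i, borel T (A i)) -> borel T [set x | forall i, A i x].
Proof.
move=> bA; rewrite -(setCK [set x | _]); apply: borelC.
have -> : ~` [set x | forall i, A i x] = \big[setU/set0]_(i : J) ~` A i.
  rewrite -bigcup_seq; apply/seteqP; split=> [x /= /existsNP[i Ai]|x [i _ Ai] h].
    by exists i => //=; rewrite mem_index_enum.
  by apply: Ai; exact: h.
by apply: borel_bigU => i; exact: borelC.
Qed.

End borel_sets.

Lemma borel_preimage (T U : topologicalType) (f : T -> U) (B : set U) :
  continuous f -> borel U B -> borel T (f @^-1` B).
Proof.
move=> /continuousP cf; move: B.
apply: (@smallest_sub _ _ _ [set B | borel T (f @^-1` B)]).
  split => /=.
  - by rewrite preimage_set0; exact: borel0.
  - by move=> A hA; rewrite setTD preimage_setC; exact: borelC.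
  - by move=> F hF; rewrite preimage_bigcup; exact: borel_bigcup.
by move=> B oB; apply: borel_open; exact: cf.
Qed.

Section union_bounds.
Context {d : measure_display} {T : measurableType d} {R : realType}.
Variable mu : {measure set T -> \bar R}.

Lemma measure_bigsetU_le {I : eqType} (r : seq I) (F : I -> set T) (c : \bar R) :
  (0 <= c)%E -> (forall i, measurable (F i)) ->
  (forall i, i \in r -> (mu (F i) <= c)%E) ->
  (mu (\big[setU/set0]_(i <- r) F i) <= (size r)%:R%:E * c)%E.
Proof.
move=> c0 mF; elim: r => [|i r IH] h; first by rewrite big_nil measure0 mul0e.
rewrite big_cons; apply: (le_trans (measureU2 mu (mF i) _)).
  exact: bigsetU_measurable.
rewrite /= -add1n natrD EFinD ge0_muleDl ?lee_fin ?ler0n// mul1e leeD ?h ?mem_head //.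
by apply: IH => j jr; apply: h; rewrite inE jr orbT.
Qed.

End union_bounds.

(** * Lines hitting a ball *)

Lemma continuous_sum {R : realType} {T : topologicalType} {I : Type} (r : seq I)
    (Q : pred I) (f : I -> T -> R) :
  (forall i, continuous (f i)) ->
  continuous (fun x => \sum_(i <- r | Q i) f i x).
Proof.
move=> cf; elim: r => [|i r IH] x.
  by under eq_fun do rewrite big_nil; exact: cvg_cst.
under eq_fun do rewrite big_cons.
by case: (Q i); [apply: cvgD; [exact: cf|exact: IH]|exact: IH].
Qed.

Lemma continuous_mul {R : realType} {T : topologicalType} (f g : T -> R) :
  continuous f -> continuous g -> continuous (fun x => f x * g x).
Proof. by move=> cf cg x; apply: cvgM; [exact: cf|exact: cg]. Qed.

Lemma continuous_prod {R : realType} {T : topologicalType} {I : Type} (r : seq I)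
    (Q : pred I) (f : I -> T -> R) :
  (forall i, continuous (f i)) ->
  continuous (fun x => \prod_(i <- r | Q i) f i x).
Proof.
move=> cf; elim: r => [|i r IH] x.
  by under eq_fun do rewrite big_nil; exact: cvg_cst.
under eq_fun do rewrite big_cons.
by case: (Q i); [apply: continuous_mul; [exact: cf|exact: IH]|exact: IH].
Qed.

Section geometry.
Context {R : realType} {d : nat}.
Implicit Types (x y p q w : 'rV[R]_d) (th g : 'M[R]_d).

Lemma rowBE x y (i : 'I_d) : (x - y) ord0 i = x ord0 i - y ord0 i.
Proof. by rewrite !mxE. Qed.

Definition sqn x : R := \sum_(i < d) x ord0 i ^+ 2.
(** The squared distance from [x] to the axis [R e1]; thus [sqn_perp (x - q)] is the squared
    distance from [q] to the line [x + R e1]. *)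
Definition sqn_perp x : R := \sum_(i < d | val i != 0%N) x ord0 i ^+ 2.

Lemma sqnE x : sqn x = (x *m x^T) ord0 ord0.
Proof. by rewrite mxE; apply: eq_bigr => i _; rewrite mxE expr2. Qed.

Lemma SO_trmul th : SO d th -> th^T *m th = 1%:M.
Proof. by case=> h _; exact: mulmx1C. Qed.

Lemma SO_mul g th : SO d g -> SO d th -> SO d (g *m th).
Proof.
move=> [g1 dg] [t1 dt]; split; last by rewrite det_mulmx dg dt mulr1.
by rewrite trmx_mul mulmxA -(mulmxA g) t1 mulmx1.
Qed.

Lemma sqn_SO th x : SO d th -> sqn (x *m th) = sqn x.
Proof. by case=> h _; rewrite !sqnE trmx_mul mulmxA -(mulmxA x) h mulmx1. Qed.

Lemma sqn_perp_ge0 x : 0 <= sqn_perp x.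
Proof. by apply: sumr_ge0 => i _; exact: sqr_ge0. Qed.

Lemma sqn_perp_le x : sqn_perp x <= sqn x.
Proof.
rewrite /sqn (bigID (fun i : 'I_d => val i != 0%N)) /= lerDl.
by apply: sumr_ge0 => i _; exact: sqr_ge0.
Qed.

Lemma sqr_sum_le (a b : R) : (a + b) ^+ 2 <= 2 * (a ^+ 2 + b ^+ 2).
Proof. have := sqr_ge0 (a - b); nra. Qed.

Lemma sqnD_le x y : sqn (x + y) <= 2 * (sqn x + sqn y).
Proof.
rewrite -big_split mulr_sumr; apply: ler_sum => i _.
by rewrite mxE; exact: sqr_sum_le.
Qed.

Lemma sqn_perpD_le x y : sqn_perp (x + y) <= 2 * (sqn_perp x + sqn_perp y).
Proof.
rewrite -big_split mulr_sumr; apply: ler_sum => i _.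
by rewrite mxE; exact: sqr_sum_le.
Qed.

Lemma sqnN x : sqn (- x) = sqn x.
Proof. by apply: eq_bigr => i _; rewrite mxE sqrrN. Qed.

Lemma sqn_perpN x : sqn_perp (- x) = sqn_perp x.
Proof. by apply: eq_bigr => i _; rewrite mxE sqrrN. Qed.

(* The strict inequality makes [gamma @^-1` hits p] open, hence Borel. *)
Definition hits p : set (set 'rV[R]_d) := [set l | exists2 q, l q & sqn (q - p) < 4^-1].

(** Rotating back by [th] preserves distances; it turns the line into [x + R e1] and [p] into
    [p *m th]. The nearest point of that line shares its first coordinate with [p *m th], so only
    the other coordinates count. *)
Lemma gamma_hits p x th : (0 < d)%N -> SO d th -> e1perp d x ->
  hits p (gamma (x, th)) <-> sqn_perp (x - p *m th) < 4^-1.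
Proof.
move=> d0 soth x0.
have dist t : sqn ((x + t *: e1) *m th^T - p) = sqn (x + t *: e1 - p *m th).
  by rewrite -(sqn_SO _ _ soth) mulmxBl -mulmxA (SO_trmul _ soth) mulmx1.
have perpE t : sqn_perp (x + t *: e1 - p *m th) = sqn_perp (x - p *m th).
  apply: eq_bigr => i i0; rewrite !mxE; rewrite (negPf i0) mulr0 addr0 //.
split=> [[q [t _ <-]]|h].
  by rewrite /= dist; apply: le_lt_trans; rewrite -(perpE t) sqn_perp_le.
pose i0 := Ordinal d0; pose t := (p *m th) ord0 i0.
exists ((x + t *: e1) *m th^T); first by exists t.
rewrite dist /sqn (bigID (fun i : 'I_d => val i != 0%N)) /= -/(sqn_perp _) perpE.
rewrite big1 ?addr0 // => i; rewrite negbK => /eqP vi.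
have -> : i = i0 by exact: val_inj.
by rewrite !mxE (x0 i0) // /= mulr1 add0r /t mxE subrr expr0n.
Qed.

Lemma coord_line_continuous t (i : 'I_d) :
  continuous (fun z : 'rV[R]_d * 'M[R]_d => ((z.1 + t *: e1) *m z.2^T) ord0 i).
Proof.
rewrite (_ : (fun _ => _) = fun z : 'rV[R]_d * 'M[R]_d =>
    \sum_j (z.1 ord0 j + t * e1 ord0 j) * z.2 i j); last first.
  by apply/funext => u; rewrite mxE; apply: eq_bigr => j _; rewrite !mxE.
apply: continuous_sum => j z; apply: cvgM; last first.
  by apply: (@continuous_comp _ _ _ snd (fun M : 'M[R]_d => M i j));
    [exact: cvg_snd|exact: coord_continuous].
apply: cvgD; last exact: cvg_cst.
by apply: (@continuous_comp _ _ _ fst (fun M : 'rV[R]_d => M ord0 j));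
  [exact: cvg_fst|exact: coord_continuous].
Qed.

(** At a fixed parameter [t] the condition is a strict inequality, continuous in the pair; the
    preimage is the union over [t] of these open sets. *)
Lemma hits_open p : open (gamma @^-1` hits p).
Proof.
have -> : gamma @^-1` hits p = \bigcup_(t in [set: R])
    ((fun z : 'rV[R]_d * 'M[R]_d => sqn ((z.1 + t *: e1) *m z.2^T - p)) @^-1`
      [set y | y < 4^-1]).
  apply/seteqP; split=> [z [q [t _ <-] h]|z [t _ h]]; first by exists t.
  by exists ((z.1 + t *: e1) *m z.2^T) => //; exists t.
apply: bigcup_open => t _; apply: open_comp; last exact: open_lt.
move=> z _; apply: continuous_sum => i {}z.
rewrite (_ : (fun _ => _) = fun u : 'rV[R]_d * 'M[R]_d =>
    (((u.1 + t *: e1) *m u.2^T) ord0 i - p ord0 i) ^+ 2); last first.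
  by apply/funext => u; rewrite !mxE.
apply: cvgM; (apply: cvgB; [exact: coord_line_continuous|exact: cvg_cst]).
Qed.

End geometry.

(** * The measure of the lines hitting a ball *)

(** The volume [c^(d-1)] of a cube of side [c] in the hyperplane orthogonal to [e1]. *)
Definition perp_vol {R : realType} (d : nat) (c : R) : R :=
  \prod_(i < d | val i != 0%N) c.

Lemma perp_vol_ge0 {R : realType} (d : nat) (c : R) : 0 <= c -> 0 <= perp_vol d c.
Proof. by move=> c0; apply: prodr_ge0. Qed.

Lemma perp_vol_gt0 {R : realType} (d : nat) (c : R) : 0 < c -> 0 < perp_vol d c.
Proof. by move=> c0; apply: prodr_gt0. Qed.

Section line_measure_bounds.
Context {R : realType} {d : nat}.
Variables (nu : set 'M[R]_d -> \bar R) (kappa : set ('rV[R]_d * 'M[R]_d) -> \bar R).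
Hypotheses (haar_nu : is_haar_SO d nu) (prod_kappa : is_leb_haar_product d nu kappa).

Local Notation BM := (borel 'M[R]_d).
Local Notation BK := (borel ('rV[R]_d * 'M[R]_d)%type).

Lemma mulmx_coord_continuous (p : 'rV[R]_d) (i : 'I_d) :
  continuous (fun th : 'M[R]_d => (p *m th) ord0 i).
Proof.
rewrite (_ : (fun _ => _) = fun th : 'M[R]_d => \sum_j p ord0 j * th j i).
  by apply: continuous_sum => j; apply: continuous_mul;
    [move=> z; exact: cst_continuous|exact: coord_continuous].
by apply/funext => th; rewrite mxE.
Qed.

Lemma borel_hbox (a b : 'rV[R]_d) : borel 'rV[R]_d (hbox a b).
Proof.
apply: borel_forall => i; case: (val i == 0%N).
  apply: borel_closed.
  apply: (@closed_comp _ _ (fun x : 'rV[R]_d => x ord0 i) [set 0]).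
    by move=> x _; exact: coord_continuous.
  exact: closed_eq.
rewrite (_ : (fun x : 'rV[R]_d => _) =
    (fun x : 'rV[R]_d => x ord0 i) @^-1` [set r | a ord0 i <= r] `&`
    (fun x : 'rV[R]_d => x ord0 i) @^-1` [set r | r <= b ord0 i]).
  by apply: borelI; apply: borel_closed; apply: closed_comp;
    [move=> x _; exact: coord_continuous|exact: closed_ge
    |move=> x _; exact: coord_continuous|exact: closed_le].
by apply/seteqP; split=> x /= => [/andP[]|[-> ->]].
Qed.

Lemma borel_fst (A : set 'rV[R]_d) : borel 'rV[R]_d A -> BK (fst @^-1` A).
Proof.
by apply: (@borel_preimage ('rV[R]_d * 'M[R]_d)%type 'rV[R]_d fst) => z; exact: cvg_fst.
Qed.

Lemma borel_snd (A : set 'M[R]_d) : BM A -> BK (snd @^-1` A).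
Proof.
by apply: (@borel_preimage ('rV[R]_d * 'M[R]_d)%type 'M[R]_d snd) => z; exact: cvg_snd.
Qed.

Lemma borel_setX (A : set 'rV[R]_d) (B : set 'M[R]_d) :
  borel 'rV[R]_d A -> BM B -> BK (A `*` B).
Proof.
by move=> bA bB; apply: (@borelI _ (fst @^-1` A) (snd @^-1` B));
  [exact: borel_fst|exact: borel_snd].
Qed.

Lemma borel_SO : BM (SO d).
Proof.
apply: (@borelI _ [set th : 'M[R]_d | th *m th^T = 1%:M] [set th | \det th = 1]).
  rewrite (_ : [set th | _] = [set th : 'M[R]_d | forall i : 'I_d, [set th : 'M[R]_d |
      forall j : 'I_d, (th *m th^T) i j = (1%:M : 'M[R]_d) i j] th]).
    apply: borel_forall => i; apply: borel_forall => j; apply: borel_closed.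
    apply: (@closed_comp _ _ (fun th : 'M[R]_d => (th *m th^T) i j)
      [set (1%:M : 'M[R]_d) i j]); last exact: closed_eq.
    move=> th _.
    rewrite (_ : (fun _ => _) = fun th : 'M[R]_d => \sum_k th i k * th j k).
      by apply: continuous_sum => k; apply: continuous_mul; exact: coord_continuous.
    by apply/funext => M; rewrite mxE; apply: eq_bigr => k _; rewrite mxE.
  apply/seteqP; split=> th /= h; first by move=> i j; rewrite h.
  by apply/matrixP.
apply: borel_closed.
apply: (@closed_comp _ _ (fun th : 'M[R]_d => \det th) [set 1]); last exact: closed_eq.
move=> th _; apply: continuous_sum => s.
apply: continuous_mul; first by move=> z; exact: cst_continuous.
by apply: continuous_prod => i; exact: coord_continuous.
Qed.

Lemma borel_e1perp : borel 'rV[R]_d (e1perp d).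
Proof.
apply: borel_forall => i.
case: (eqVneq (val i) 0%N) => i0; last first.
  rewrite (_ : (fun _ => _) = setT); first exact: borelT.
  by apply/seteqP; split => // x _ /eqP; rewrite (negPf i0).
rewrite (_ : (fun _ => _) = (fun x : 'rV[R]_d => x ord0 i) @^-1` [set 0]).
  apply: borel_closed; apply: closed_comp; last exact: closed_eq.
  by move=> x _; exact: coord_continuous.
by apply/seteqP; split=> x /=; [exact|].
Qed.

Lemma hbox_e1perp (a b : 'rV[R]_d) : hbox a b `<=` e1perp d.
Proof. by move=> x h i i0; have := h i; rewrite i0 eqxx. Qed.

(** Disjoint [F n] make the products disjoint even where the boxes overlap, so countable additivity
    measures a set of pairs whose range of positions varies with the rotation. *)
Lemma kappa_disjoint_boxes (a b : nat -> 'rV[R]_d) (F : nat -> set 'M[R]_d) (v : R) :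
  (forall n i, a n ord0 i <= b n ord0 i) -> (forall n, hvol (a n) (b n) = v) ->
  (forall n, BM (F n)) -> trivIset setT F ->
  kappa (\bigcup_n (hbox (a n) (b n) `*` F n)) = (v%:E * nu (\bigcup_n F n))%E.
Proof.
move=> ab vE bF tF.
have [mN _ _ _] := haar_nu; have [mK _ boxE] := prod_kappa.
have [N NE] := measure_of_is_measure _ _ mN; have [K KE] := measure_of_is_measure _ _ mK.
have bbox n : BK (hbox (a n) (b n) `*` F n).
  by apply: borel_setX => //; exact: borel_hbox.
rewrite -KE; last exact: borel_bigcup.
rewrite -NE; last exact: borel_bigcup.
have v0 : 0 <= v.
  by rewrite -(vE 0%N); apply: prodr_ge0 => i _; rewrite subr_ge0.
rewrite measure_semi_bigcup //; last 2 first.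
  by apply/trivIsetP => i j _ _ ij; move/trivIsetP : tF => /(_ i j I I ij) Fij;
    rewrite -subset0 => -[x th] [[_ /= Fi] [_ /= Fj]];
    suff : (F i `&` F j) th by rewrite Fij.
  exact: borel_bigcup.
rewrite measure_semi_bigcup //; last exact: borel_bigcup.
rewrite -nneseriesZl //.
apply: eq_eseriesr => n _; rewrite /= KE; last exact: bbox.
by rewrite NE; [rewrite -(vE n); exact: boxE|exact: bF].
Qed.

Section cells.
Variables (s : R) (p : 'rV[R]_d).
Hypothesis s0 : 0 < s.

(* [kappa] is only known on products, so Fubini is replaced by a decomposition
   of the matrices according to the cell of side [s] containing [p *m th]. *)
Definition cell_index (th : 'M[R]_d) : 'rV[int]_d :=
  \row_i Num.floor ((p *m th) ord0 i / s).

Definition cell (n : nat) : set 'M[R]_d := [set th | pickle (cell_index th) = n].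

(** The default [0] is harmless: if [n] decodes to no vector, its cell is empty. *)
Definition corner (n : nat) : 'rV[R]_d :=
  \row_i (s * ((odflt 0 (unpickle n) : 'rV[int]_d) ord0 i)%:~R).

Lemma corner_cell n th i : cell n th ->
  corner n ord0 i <= (p *m th) ord0 i <= corner n ord0 i + s.
Proof.
move=> <-; rewrite [corner _ _ _]mxE pickleK /= [cell_index _ _ _]mxE.
set y := (p *m th) ord0 i; apply/andP; split.
  by rewrite mulrC -ler_pdivlMr // floor_le.
rewrite -[X in _ + X]mulr1 -mulrDr mulrC -ler_pdivrMr // ltW //.
by have := floorD1_gt (y / s); rewrite intrD.
Qed.

Lemma borel_cell n : BM (cell n).
Proof.
have [[z zn]|nz] := pselect (exists z : 'rV[int]_d, pickle z = n); last first.
  rewrite (_ : cell n = set0); first exact: borel0.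
  by rewrite -subset0 => th thn; apply: nz; exists (cell_index th).
rewrite (_ : cell n = [set th | forall i : 'I_d, [set th : 'M[R]_d |
    (s * (z ord0 i)%:~R <= (p *m th) ord0 i) /\
    ~ (s * (z ord0 i + 1)%:~R <= (p *m th) ord0 i)] th]).
  apply: borel_forall => i.
  apply: (@borelI _
    ((fun th : 'M[R]_d => (p *m th) ord0 i) @^-1` [set r | s * (z ord0 i)%:~R <= r])
    (~` ((fun th : 'M[R]_d => (p *m th) ord0 i) @^-1`
      [set r | s * (z ord0 i + 1)%:~R <= r]))).
    apply: borel_closed; apply: closed_comp; last exact: closed_ge.
    by move=> th _; exact: mulmx_coord_continuous.
  apply: borelC.
  apply: borel_closed; apply: closed_comp; last exact: closed_ge.
  by move=> th _; exact: mulmx_coord_continuous.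
have key th i : (s * (z ord0 i)%:~R <= (p *m th) ord0 i) /\
    ~ (s * (z ord0 i + 1)%:~R <= (p *m th) ord0 i) <-> cell_index th ord0 i = z ord0 i.
  rewrite [cell_index _ _ _]mxE; split.
    move=> [h1 /negP]; rewrite -ltNge => h2; apply: floor_def.
    by rewrite ler_pdivlMr // mulrC h1 ltr_pdivrMr // mulrC h2.
  move=> <-; split.
    by rewrite mulrC -ler_pdivlMr // floor_le.
  by apply/negP; rewrite -ltNge mulrC -ltr_pdivrMr // floorD1_gt.
apply/seteqP; split=> th /=.
  move=> thn i; apply/key; congr (fun_of_matrix _ _ _).
  by apply: (pcan_inj pickleK); rewrite zn.
move=> h; rewrite -zn; congr pickle; apply/rowP => i; exact/key/h.
Qed.

Lemma trivIset_cell (C : set 'M[R]_d) : trivIset setT (fun n => cell n `&` C).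
Proof. by move=> i j _ _ [th [[<- _] [<- _]]]. Qed.

Lemma bigcup_cell (C : set 'M[R]_d) : \bigcup_n (cell n `&` C) = C.
Proof.
apply/seteqP; split=> [th [n _ []]//|th Cth].
by exists (pickle (cell_index th)).
Qed.

End cells.

(** For [th] in a cell, the box of side [s] at its corner contains the projection of [p *m th]. Any
    [x] in the box is then within [s] of [p *m th] in each coordinate but the first, and the line
    hits the ball. These boxes have total measure [perp_vol d s], as [nu] gives [SO d] mass 1. *)
Lemma kappa_hits_ge (s : R) (p : 'rV[R]_d) : (0 < d)%N -> 0 < s -> d%:R * s ^+ 2 < 4^-1 ->
  ((perp_vol d s)%:E <= kappa (gamma @^-1` hits p))%E.
Proof.
move=> d0 s0 sd.
have [mN nSO nT _] := haar_nu; have [mK kE boxE] := prod_kappa.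
have [N NE] := measure_of_is_measure _ _ mN; have [K KE] := measure_of_is_measure _ _ mK.
have bhits : BK (gamma @^-1` hits p) by apply: borel_open; exact: hits_open.
pose F n := cell s p n `&` SO d.
have bF n : BM (F n) by apply: borelI; [exact: borel_cell|exact: borel_SO].
pose b n : 'rV[R]_d := \row_i (corner s n ord0 i + s).
have ab n i : corner s n ord0 i <= b n ord0 i by rewrite [b n _ _]mxE lerDl ltW.
have vE n : hvol (corner s n) (b n) = perp_vol d s.
  by apply: eq_bigr => i _; rewrite [b n _ _]mxE addrAC subrr add0r.
have nuSO : nu (SO d) = 1%E.
  have bSO := borel_SO.
  have mSO : @measurable _ (g_sigma_algebraType (@open 'M[R]_d)) (SO d) by [].
  rewrite -nT -!NE //; last exact: borelT.
  rewrite -(setUv (SO d)) measureU //; last by rewrite setICr.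
    by rewrite /= (NE (~` _)) ?nSO ?adde0 //; exact: borelC.
  exact: measurableC.
have := kappa_disjoint_boxes _ _ F _ ab vE bF (trivIset_cell _ _ _).
rewrite bigcup_cell nuSO mule1 => <-.
have bU : BK (\bigcup_n (hbox (corner s n) (b n) `*` F n)).
  by apply: borel_bigcup => n; apply: borel_setX => //; exact: borel_hbox.
rewrite -!KE //; apply: le_measure; rewrite ?inE //.
move=> [x th] [n _ [/= hx [cth soth]]].
apply/gamma_hits => //; first exact: hbox_e1perp hx.
apply: le_lt_trans sd.
have -> : d%:R * s ^+ 2 = \sum_(i < d) s ^+ 2.
  by rewrite sumr_const card_ord mulr_natl.
rewrite [leRHS](bigID (fun i : 'I_d => val i != 0%N)) /= -[leLHS]addr0.
apply: lerD; last by apply: sumr_ge0 => i _; exact: sqr_ge0.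
apply: ler_sum => i i0.
have := hx i; rewrite (negPf i0) [b n _ _]mxE.
have := corner_cell s p s0 n th i cth.
rewrite rowBE.
by set u := (p *m th) _ _; set w := corner _ _ _ _ => /andP[? ?] /andP[? ?]; nra.
Qed.

(** A hitting [x] is within 1/2 of [p *m th] in each coordinate but the first, so it lies in the box
    of the cell widened by 1/2 on every side. Pairs that are not in [e1perp d] times [SO d] form a
    null set. *)
Lemma kappa_hits_le (s : R) (p : 'rV[R]_d) (C : set 'M[R]_d) : (0 < d)%N -> 0 < s ->
  BM C -> (kappa (gamma @^-1` hits p `&` snd @^-1` C) <= (perp_vol d (s + 1))%:E * nu C)%E.
Proof.
move=> d0 s0 bC.
have [mN nSO nT _] := haar_nu; have [mK kE boxE] := prod_kappa.
have [N NE] := measure_of_is_measure _ _ mN; have [K KE] := measure_of_is_measure _ _ mK.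
have bhits : BK (gamma @^-1` hits p `&` snd @^-1` C).
  by apply: borelI; [apply: borel_open; exact: hits_open|exact: borel_snd].
pose F n := cell s p n `&` C.
have bF n : BM (F n) by apply: borelI => //; exact: borel_cell.
pose a n : 'rV[R]_d := \row_i (corner s n ord0 i - 2^-1).
pose b n : 'rV[R]_d := \row_i (corner s n ord0 i + s + 2^-1).
have ab n i : a n ord0 i <= b n ord0 i by rewrite [b n _ _]mxE [a n _ _]mxE; lra.
have vE n : hvol (a n) (b n) = perp_vol d (s + 1).
  by apply: eq_bigr => i _; rewrite [b n _ _]mxE [a n _ _]mxE; lra.
have := kappa_disjoint_boxes _ _ F _ ab vE bF (trivIset_cell _ _ _).
rewrite bigcup_cell => <-.
have bU : BK (\bigcup_n (hbox (a n) (b n) `*` F n)).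
  by apply: borel_bigcup => n; apply: borel_setX => //; exact: borel_hbox.
have bE : BK (~` (e1perp d `*` SO d)).
  by apply: borelC; apply: borel_setX; [exact: borel_e1perp|exact: borel_SO].
rewrite -!KE //.
have := measureU2 K bU bE; rewrite [X in _ + X]KE // kE adde0.
apply: le_trans; apply: le_measure; rewrite ?inE //; first exact: borelU.
move=> [x th] [hit /= Cth].
have [[/= ex soth]|] := pselect ((e1perp d `*` SO d) (x, th)); last by right.
left; exists (pickle (cell_index s p th)) => //; split => //= i.
case: ifPn => [/eqP /ex //|i0].
have cth : cell s p (pickle (cell_index s p th)) th by [].
have := corner_cell s p s0 _ th i cth.
have /gamma_hits - /(_ d0 soth ex) := hit.
rewrite /sqn_perp (bigD1 i) //= => h.
have : (x - p *m th) ord0 i ^+ 2 < 4^-1.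
  by apply: le_lt_trans h; rewrite lerDl; apply: sumr_ge0 => j _; exact: sqr_ge0.
rewrite [b _ _ _]mxE [a _ _ _]mxE rowBE.
by set u := (p *m th) _ _; set w := corner _ _ _ _ => ? /andP[? ?]; apply/andP; split; nra.
Qed.

End line_measure_bounds.

(** * Rotations in a coordinate plane *)

Section rotations.
Context {R : realType} {d : nat}.
Implicit Types (x w : 'rV[R]_d) (i j : 'I_d) (phi psi : R).

Definition plane_rot i j phi : 'M[R]_d :=
  1%:M + (cos phi - 1) *: (delta_mx i i + delta_mx j j)
       + sin phi *: (delta_mx i j - delta_mx j i).

Lemma row_mul_delta x i j k : (x *m delta_mx i j) ord0 k = x ord0 i * (k == j)%:R.
Proof.
rewrite mxE (bigD1 i) //= big1 => [|l li]; last by rewrite mxE (negPf li) mulr0.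
by rewrite mxE eqxx /= addr0.
Qed.

Lemma row_mul_plane_rot x i j phi k : i != j ->
  (x *m plane_rot i j phi) ord0 k =
    if k == i then cos phi * x ord0 i - sin phi * x ord0 j
    else if k == j then sin phi * x ord0 i + cos phi * x ord0 j
    else x ord0 k.
Proof.
move=> ij.
have -> : (x *m plane_rot i j phi) ord0 k = x ord0 k
    + (cos phi - 1) * (x ord0 i * (k == i)%:R + x ord0 j * (k == j)%:R)
    + sin phi * (x ord0 i * (k == j)%:R - x ord0 j * (k == i)%:R).
  rewrite /plane_rot !mulmxDr mulmx1 -!scalemxAr mulmxDr mulmxBr.
  by rewrite -!row_mul_delta !mxE.
case: (eqVneq k i) => [->|ki]; first by rewrite (negPf ij) /=; ring.
by case: (eqVneq k j) => [->|kj] /=; ring.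
Qed.

Lemma mul_plane_rot i j phi psi : i != j ->
  plane_rot i j phi *m plane_rot i j psi = plane_rot i j (phi + psi).
Proof.
move=> ij; apply/row_matrixP => l; rewrite !rowE mulmxA; apply/rowP => k.
have ji : (j == i) = false by rewrite eq_sym (negPf ij).
rewrite !row_mul_plane_rot // !eqxx ji cosD sinD.
by case: (k == i); [ring|case: (k == j) => //; ring].
Qed.

Lemma plane_rot0 i j : plane_rot i j 0 = 1%:M.
Proof. by rewrite /plane_rot cos0 sin0 subrr !scale0r !addr0. Qed.

Lemma trmx_plane_rot i j phi : (plane_rot i j phi)^T = plane_rot i j (- phi).
Proof.
apply/matrixP => k l; rewrite !mxE cosN sinN [l == k]eq_sym.
by rewrite ![(l == _) && _]andbC; ring.
Qed.

Lemma plane_rot_SO i j phi : i != j -> SO d (plane_rot i j phi).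
Proof.
move=> ij.
have orth psi : plane_rot i j psi *m (plane_rot i j psi)^T = 1%:M.
  by rewrite trmx_plane_rot mul_plane_rot // subrr plane_rot0.
split; first exact: orth.
have -> : phi = phi / 2 + phi / 2 by lra.
(* a rotation is the square of the half-angle one, so its determinant is 1 *)
have := congr1 determinant (orth (phi / 2)).
by rewrite -mul_plane_rot // !det_mulmx det_tr det1.
Qed.

Lemma sqn_ge2 x i j : i != j -> x ord0 i ^+ 2 + x ord0 j ^+ 2 <= sqn x.
Proof.
move=> ij; rewrite /sqn (bigD1 i) //= (bigD1 j) 1?eq_sym //= addrA lerDl.
by apply: sumr_ge0 => k _; exact: sqr_ge0.
Qed.

(** Factoring out one rotation leaves [w] minus its rotate by the angle difference. In the plane
    this chord has squared length [2 - 2 cos] times that of the projection of [w], of which only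
    coordinate [i] is kept. *)
Lemma sqn_sub_plane_rot w i j phi psi : i != j ->
  (2 - 2 * cos (psi - phi)) * w ord0 i ^+ 2 <=
    sqn (w *m plane_rot i j phi - w *m plane_rot i j psi).
Proof.
move=> ij; set c := psi - phi.
have -> : w *m plane_rot i j phi - w *m plane_rot i j psi =
    (w - w *m plane_rot i j c) *m plane_rot i j phi.
  by rewrite mulmxBl -mulmxA mul_plane_rot // /c subrK.
rewrite sqn_SO; last exact: plane_rot_SO.
apply: le_trans (sqn_ge2 _ _ _ ij).
rewrite !rowBE !row_mul_plane_rot // !eqxx [j == i]eq_sym (negPf ij).
have := cos2Dsin2 c; have := cos_le1 c.
move: (cos c) (sin c) (w ord0 i) (w ord0 j) => C S a b C1 CS.
have -> : (a - (C * a - S * b)) ^+ 2 + (b - (S * a + C * b)) ^+ 2 =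
  (1 - 2 * C + (C ^+ 2 + S ^+ 2)) * (a ^+ 2 + b ^+ 2) by ring.
rewrite CS; have := sqr_ge0 b; nra.
Qed.

(** The counterpart for opposite vectors, since a line determines its direction only up to sign. *)
Lemma sqn_add_plane_rot w i j phi psi : i != j ->
  (2 + 2 * cos (psi - phi)) * w ord0 i ^+ 2 <=
    sqn (w *m plane_rot i j phi + w *m plane_rot i j psi).
Proof.
move=> ij; set c := psi - phi.
have -> : w *m plane_rot i j phi + w *m plane_rot i j psi =
    (w + w *m plane_rot i j c) *m plane_rot i j phi.
  by rewrite mulmxDl -mulmxA mul_plane_rot // /c subrK.
rewrite sqn_SO; last exact: plane_rot_SO.
apply: le_trans (sqn_ge2 _ _ _ ij).
rewrite ![(w + _) _ _]mxE !row_mul_plane_rot // !eqxx [j == i]eq_sym (negPf ij).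
have := cos2Dsin2 c; have := cos_geN1 c.
move: (cos c) (sin c) (w ord0 i) (w ord0 j) => C S a b C1 CS.
have -> : (a + (C * a - S * b)) ^+ 2 + (b + (S * a + C * b)) ^+ 2 =
  (1 + 2 * C + (C ^+ 2 + S ^+ 2)) * (a ^+ 2 + b ^+ 2) by ring.
rewrite CS; have := sqr_ge0 b; nra.
Qed.

(** Halving the angle: if [2 C^2 - 1 <= 1 - e], then [C^2 <= 1 - e/2 <= (1 - e/4)^2]. *)
Lemma cos_dyadic_le k : cos (pi / 2 / 2 ^+ k : R) <= 1 - 4 ^- k.
Proof.
elim: k => [|k IH]; first by rewrite !expr0 divr1 cos_pihalf invr1 subrr.
set psi := (pi / 2 / 2 ^+ k.+1 : R).
have E : pi / 2 / 2 ^+ k = psi *+ 2.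
  rewrite /psi exprS -mulr_natr; field.
  by rewrite expf_neq0.
move: IH; rewrite E cos_mulr2n => IH.
rewrite exprS invfM; move: IH; rewrite -mulr_natr.
have : 0 < (4 ^- k : R) by rewrite invr_gt0 exprn_gt0.
move: (cos psi) (4 ^- k) => C e e0 IH.
rewrite leNgt; apply/negP => Ce.
have e2 : e <= 2 by have := sqr_ge0 C; lra.
have : (1 - 4^-1 * e) ^+ 2 < C ^+ 2 by rewrite ltr_pXn2r // ?nnegrE; lra.
have := sqr_ge0 e; lra.
Qed.

End rotations.

(** * Lines hitting two distant balls *)

Section caps.
Context {R : realType} {d : nat}.
Variables (nu : set 'M[R]_d -> \bar R) (kappa : set ('rV[R]_d * 'M[R]_d) -> \bar R).
Hypotheses (haar_nu : is_haar_SO d nu) (prod_kappa : is_leb_haar_product d nu kappa).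
Implicit Types (p q w : 'rV[R]_d) (i j : 'I_d).

(* Contains every rotation sending [e1] to the direction of a line that hits
   two balls of radius 1/2 whose centres differ by [w]. *)
Definition cap w : set 'M[R]_d := SO d `&` [set th | sqn_perp (w *m th) <= 1].

Lemma borel_cap w : borel 'M[R]_d (cap w).
Proof.
apply: borelI; first exact: borel_SO.
apply: borel_closed.
apply: (@closed_comp _ _ (fun th : 'M[R]_d => sqn_perp (w *m th)) [set r | r <= 1]);
  last exact: closed_le.
move=> th _; apply: continuous_sum => i.
rewrite (_ : (fun _ => _) = fun th : 'M[R]_d => (w *m th) ord0 i * (w *m th) ord0 i).
  by apply: continuous_mul; exact: mulmx_coord_continuous.
by apply/funext => M; rewrite expr2.
Qed.

(** Left multiplication by [g] maps [cap (w *m g)] onto [cap w], and [nu] is left invariant. *)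
Lemma cap_rotate w g : SO d g -> nu (cap (w *m g)) = nu (cap w).
Proof.
move=> sog; have [_ _ _ inv] := haar_nu.
rewrite -(inv g) //; last exact: borel_cap.
congr nu; apply/seteqP; split=> [_ [X [soX cX] <-]|th [soth cth]].
  by split; [exact: SO_mul|rewrite /= mulmxA].
have sogT : SO d g^T.
  by case: (sog) => _ dg; split; rewrite ?trmxK ?det_tr //; exact: SO_trmul.
exists (g^T *m th); last by rewrite mulmxA (proj1 sog) mul1mx.
split; first exact: SO_mul.
by rewrite /= mulmxA -(mulmxA w) (proj1 sog) mulmx1.
Qed.

Lemma sqr_sub_le (x y : R) : 0 <= x * y -> (x - y) ^+ 2 <= `|x ^+ 2 - y ^+ 2|.
Proof.
move=> xy; rewrite subr_sqr normrM -[leLHS]real_normK ?num_real // expr2.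
apply: ler_wpM2l; first exact: normr_ge0.
rewrite -ler_sqr ?nnegrE // !real_normK ?num_real //; lra.
Qed.

(** After rotation by [th], both vectors have squared distance at most 1 to the axis, so the squares
    of their first coordinates differ by at most 1. Up to a sign, the first coordinates then
    contribute at most 1 and the others at most 4. *)
Lemma cap_meet w w' th : (0 < d)%N -> sqn w = sqn w' -> cap w th -> cap w' th ->
  sqn (w - w') <= 5 \/ sqn (w + w') <= 5.
Proof.
move=> d0 ww' [soth cw] [_ cw'].
pose i0 := Ordinal d0.
have sqn0 x : sqn x = x ord0 i0 ^+ 2 + sqn_perp x.
  by rewrite /sqn (bigD1 i0).
rewrite -(sqn_SO _ (w - w') soth) -(sqn_SO _ (w + w') soth) mulmxBl mulmxDl.
move: cw cw' ww'; rewrite /= -(sqn_SO _ w soth) -(sqn_SO _ w' soth).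
move: (w *m th) (w' *m th) => a b ca cb; rewrite !sqn0 => ab.
have := sqn_perpD_le a (- b); rewrite sqn_perpN.
have := sqn_perpD_le a b.
have := sqn_perp_ge0 a; have := sqn_perp_ge0 b.
rewrite rowBE [(a + b) _ _]mxE.
move: ca cb ab; move: (sqn_perp a) (sqn_perp b) (sqn_perp (a + b)) (sqn_perp (a - b))
  => A B D E; move: (a _ _) (b _ _) => x y A1 B1 xy B0 A0 hD hE.
have ler1 : `|x ^+ 2 - y ^+ 2| <= 1 by rewrite ler_norml; apply/andP; split; lra.
have [xy0|xy0] := lerP 0 (x * y); [left|right].
  by have := sqr_sub_le _ _ xy0; lra.
have := sqr_sub_le x (- y); rewrite mulrN opprK sqrrN => /(_ _); lra.
Qed.

Lemma cap_le w i k : (1 < d)%N -> 2 ^+ k.+1 <= `|w ord0 i| ->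
  (nu (cap w) <= (2 ^- k)%:E)%E.
Proof.
move=> d1 wi.
have d0 : (0 < d)%N by exact: ltnW.
have [j ij] : exists j : 'I_d, i != j.
  have [i0|i0] := eqVneq i (Ordinal d0); last by exists (Ordinal d0).
  by exists (Ordinal d1); rewrite i0.
have [mN nSO nT _] := haar_nu.
have [N NE] := measure_of_is_measure _ _ mN.
(* the [2 ^ k] rotates of the cap by multiples of [pi / 2 / 2 ^ k] are disjoint *)
pose wm (m : nat) := w *m plane_rot i j (pi / 2 / 2 ^+ k * m%:R).
have pow_gt0 : 0 < (2 : R) ^+ k by exact: exprn_gt0.
have pi2 : 0 < (pi : R) / 2 by rewrite divr_gt0 // pi_gt0.
have pik : 0 < (pi : R) / 2 / 2 ^+ k by rewrite divr_gt0.
(* The angle difference lies between [pi / 2 / 2 ^ k] and [pi / 2], so its cosine is between 0 and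
   [1 - 4 ^- k]. As the square of [w ord0 i] is at least [4 * 4 ^ k], both squared norms are at
   least 8, beyond the 5 of [cap_meet]. *)
have sep m m' : (m < m')%N -> (m' < 2 ^ k)%N ->
    5 < sqn (wm m - wm m') /\ 5 < sqn (wm m + wm m').
  move=> mm' m'k.
  have wi2 : 4 ^+ k.+1 <= w ord0 i ^+ 2.
    rewrite -[w ord0 i ^+ 2]real_normK ?num_real //.
    have -> : (4 : R) ^+ k.+1 = (2 ^+ k.+1) ^+ 2.
      by rewrite exprAC; congr (_ ^+ _); rewrite expr2; lra.
    by rewrite lerXn2r ?nnegrE ?exprn_ge0.
  have e0 : 0 < (4 ^- k : R) by rewrite invr_gt0 exprn_gt0.
  have we : 4 <= w ord0 i ^+ 2 * 4 ^- k.
    by rewrite ler_pdivlMr ?exprn_gt0 // -exprS.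
  have e1 : (4 ^- k : R) <= 1 by rewrite invf_le1 ?exprn_gt0 // exprn_ege1 //; lra.
  pose c : R := pi / 2 / 2 ^+ k * m'%:R - pi / 2 / 2 ^+ k * m%:R.
  have cE : c = (pi : R) / 2 / 2 ^+ k * (m' - m)%:R by rewrite /c -mulrBr natrB // ltnW.
  have c_ge : (pi : R) / 2 / 2 ^+ k <= c.
    by rewrite cE -[leLHS]mulr1 ler_pM2l // ler1n subn_gt0.
  have c_le : c <= pi / 2.
    rewrite cE mulrAC ler_pdivrMr // ler_pM2l //.
    by rewrite -natrX ler_nat (leq_trans (leq_subr _ _)) // ltnW.
  have cosc : cos c <= 1 - 4 ^- k.
    apply: le_trans (cos_dyadic_le k).
    have := pi_gt0 R => pi0.
    rewrite leNgt ltr_cos ?in_itv /= -?leNgt //; apply/andP; split; lra.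
  have cosc0 : 0 <= cos c.
    by apply: cos_ge0_pihalf; apply/andP; split; lra.
  have := sqn_sub_plane_rot w _ _ (pi / 2 / 2 ^+ k * m%:R) (pi / 2 / 2 ^+ k * m'%:R) ij.
  have := sqn_add_plane_rot w _ _ (pi / 2 / 2 ^+ k * m%:R) (pi / 2 / 2 ^+ k * m'%:R) ij.
  rewrite -/c -/(wm m) -/(wm m') => h1 h2; split.
    by apply: lt_le_trans h2; nra.
  by apply: lt_le_trans h1; nra.
have sqn_wm m : sqn (wm m) = sqn w by apply: sqn_SO; exact: plane_rot_SO.
have disj_lt (m m' : nat) th : (m < m')%N -> (m' < 2 ^ k)%N ->
    cap (wm m) th -> cap (wm m') th -> False.
  move=> mm' m'k cm cm'; have [h1 h2] := sep _ _ mm' m'k.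
  have /(_ (etrans (sqn_wm m) (esym (sqn_wm m')))) := cap_meet _ _ _ d0 _ cm cm'.
  by case; rewrite leNgt ?h1 ?h2.
have disj : trivIset [set: 'I_(2 ^ k)] (fun m : 'I_(2 ^ k) => cap (wm m)).
  apply/trivIsetP => m m' _ _ mm'; rewrite -subset0 => th [cm cm'].
  have [lt|lt|/val_inj eq] := ltngtP m m'; last by rewrite eq eqxx in mm'.
    exact: (disj_lt m m' th).
  exact: (disj_lt m' m th).
have mcap v : @measurable _ (g_sigma_algebraType (@open 'M[R]_d)) (cap v).
  exact: (borel_cap v).
have mT : @measurable _ (g_sigma_algebraType (@open 'M[R]_d)) [set: 'M[R]_d].
  exact: borelT.
have N1 : N [set: 'M[R]_d] = 1%E by rewrite NE.
have : (N (\big[setU/set0]_(m < 2 ^ k) cap (wm m)) <= 1)%E.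
  rewrite -N1; apply: le_measure; rewrite ?inE //.
  by apply: bigsetU_measurable => m _; exact: mcap.
have := measure_bigsetU_ord N xpredT (fun m : 'I_(2 ^ k) => mcap (wm m)) disj.
move=> ->.
have capE m : N (cap (wm m)) = N (cap w).
  rewrite !NE; [|exact: mcap..].
  by apply: cap_rotate; exact: plane_rot_SO.
rewrite (eq_bigr (fun=> N (cap w))); last by move=> m _; exact: capE.
have capf : N (cap w) \is a fin_num.
  rewrite ge0_fin_numE // (@le_lt_trans _ _ 1%E) ?ltry // -N1.
  by apply: le_measure; rewrite ?inE.
rewrite -NE; last exact: mcap.
rewrite -(fineK capf) sumEFin !lee_fin sumr_const card_ord -[fine _ *+ _]mulr_natr natrX.
by rewrite -ler_pdivlMr // mul1r.
Qed.

(** If a line hits both balls, [x - p *m th] and [x - q *m th] have [sqn_perp] below 1/4, so their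
    difference [(p - q) *m th] has it below 1. This puts [th] in [cap (p - q)]. *)
Lemma kappa_hits2_le (s : R) p q i k : (1 < d)%N -> 0 < s ->
  2 ^+ k.+1 <= `|p ord0 i - q ord0 i| ->
  (kappa (gamma @^-1` hits p `&` gamma @^-1` hits q) <= (perp_vol d (s + 1) * 2 ^- k)%:E)%E.
Proof.
move=> d1 s0 pq.
have d0 : (0 < d)%N by exact: ltnW.
have [mK kE boxE] := prod_kappa.
have [K KE] := measure_of_is_measure _ _ mK.
have bh r : borel ('rV[R]_d * 'M[R]_d)%type (gamma @^-1` hits r).
  by apply: borel_open; exact: hits_open.
have bE : borel ('rV[R]_d * 'M[R]_d)%type (~` (e1perp d `*` SO d)).
  by apply: borelC; apply: borel_setX; [exact: borel_e1perp|exact: borel_SO].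
have bC : borel ('rV[R]_d * 'M[R]_d)%type (gamma @^-1` hits p `&` snd @^-1` cap (p - q)).
  by apply: borelI => //; apply: borel_snd; exact: borel_cap.
apply: (@le_trans _ _ ((perp_vol d (s + 1))%:E * nu (cap (p - q)))%E); last first.
  rewrite EFinM lee_pmul //.
  - rewrite lee_fin; apply: prodr_ge0 => j _; lra.
  - by have [[_ + _] _ _ _] := haar_nu; apply; exact: borel_cap.
  - by apply: (@cap_le _ i) => //; rewrite rowBE.
apply: le_trans (kappa_hits_le nu kappa haar_nu prod_kappa s p _ d0 s0 (borel_cap _)).
rewrite -!KE //; last exact: borelI.
have := measureU2 K bC bE; rewrite [X in (_ <= _ + X)%E]KE // kE adde0.
apply: le_trans; apply: le_measure; rewrite ?inE //; [exact: borelI|exact: borelU|].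
move=> [x th] [hp hq].
have [[/= ex soth]|] := pselect ((e1perp d `*` SO d) (x, th)); last by right.
left; split=> //; split=> //=.
move/gamma_hits : hp => /(_ d0 soth ex) hp; move/gamma_hits : hq => /(_ d0 soth ex) hq.
have := sqn_perpD_le (x - q *m th) (- (x - p *m th)); rewrite sqn_perpN.
have -> : x - q *m th + - (x - p *m th) = (p - q) *m th.
  by rewrite mulmxBl opprB addrC addrA subrK.
lra.
Qed.

End caps.

(** * Trees of crossings *)

Lemma continuous_dist {R : realType} {V : normedModType R} (x : V) :
  continuous (fun y => `|y - x|).
Proof. by move=> y; apply: cvg_norm; apply: cvgB; [exact: cvg_id|exact: cvg_cst]. Qed.

Section row_norm.
Context {R : realType} {d : nat}.
Implicit Types (x : 'rV[R]_d).

Lemma coord_le_norm x i : `|x ord0 i| <= `|x|.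
Proof.
rewrite [leRHS]/Num.norm /= mx_normrE.
by apply/bigmax_geP; right; exists (ord0, i).
Qed.

Lemma norm_le_coord x a : 0 <= a -> (forall i, `|x ord0 i| <= a) -> `|x| <= a.
Proof.
move=> a0 xa; rewrite [leLHS]/Num.norm /= mx_normrE.
by apply/bigmax_leP; split=> // -[i j] _ /=; rewrite ord1.
Qed.

(** The trees measure distances in the max-norm; the coordinate found here is the one that
    [kappa_hits2_le] asks for. *)
Lemma norm_attained x : 0 < `|x| -> exists i, `|x| = `|x ord0 i|.
Proof.
move=> x0; have /mx_norm_neq0[[i j] /= xE] : mx_norm x != 0 by rewrite gt_eqF.
by exists j; rewrite {1}/Num.norm /= xE ord1.
Qed.

End row_norm.

(* Shifted by [2 * B], an offset is an integer vector of norm at most [2 * B]. *)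
Definition offset (d B : nat) : finType := {ffun 'I_d -> 'I_(4 * B).+1}.

(** Offsets are relative to the parent and in units of the current scale, so one finite type of
    offsets serves every level. *)
Fixpoint tree_code (d B n : nat) : finType :=
  if n is n'.+1
  then (offset d B * offset d B * (tree_code d B n' * tree_code d B n'))%type
  else unit.

(** A binary tree with [2 ^ n] leaves has [2 ^ n - 1] inner nodes, each carrying two offsets; the
    extra factor on the left avoids a truncated subtraction. *)
Lemma card_tree_code d B n :
  (#|tree_code d B n| * #|offset d B| ^ 2 = (#|offset d B| ^ 2) ^ (2 ^ n))%N.
Proof.
elim: n => [|n IH] /=; first by rewrite card_unit mul1n expn1.
rewrite !card_prod (_ : 2 ^ n.+1 = 2 ^ n + 2 ^ n)%N; last by rewrite expnS mul2n addnn.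
rewrite expnD -IH -mulnn; move: #|_| #|_| => a b; lia.
Qed.


Section trees.
Context {R : realType} {d : nat}.
Variables (r : R) (B : nat).
Hypotheses (r0 : 0 < r) (B4 : (4 <= B)%N).
Implicit Types (x y : 'rV[R]_d) (T : seq 'rV[R]_d).

Definition scale (n : nat) : R := r * B%:R ^+ n.

Lemma scale_gt0 n : 0 < scale n.
Proof. by rewrite mulr_gt0 // exprn_gt0 // ltr0n (leq_trans _ B4). Qed.

Lemma scaleS n : scale n.+1 = B%:R * scale n.
Proof. by rewrite /scale exprS mulrCA. Qed.

Lemma scaleS_ge n : 4 * scale n <= scale n.+1.
Proof. by rewrite scaleS ler_pM2r ?scale_gt0 // ler_nat. Qed.

(** The children stand for points of the path on the spheres of radii [scale n.+1] and
    [2 * scale n.+1] around [x], rounded with an error of at most [scale n]; hence the three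
    bounds. *)
Inductive spread : nat -> 'rV[R]_d -> seq 'rV[R]_d -> Prop :=
| spread_leaf x : spread 0 x [:: x]
| spread_node n x y1 y2 T1 T2 :
    `|y1 - x| <= 2 * scale n.+1 + scale n -> `|y2 - x| <= 2 * scale n.+1 + scale n ->
    scale n.+1 - 2 * scale n <= `|y1 - y2| ->
    spread n y1 T1 -> spread n y2 T2 -> spread n.+1 x (T1 ++ T2).

Lemma size_spread n x T : spread n x T -> size T = (2 ^ n)%N.
Proof.
elim=> // {}n {}x y1 y2 T1 T2 _ _ _ _ IH1 _ IH2.
by rewrite size_cat IH1 IH2 expnS mul2n addnn.
Qed.

(** The factor 3 is inductive: [2 * scale n.+1 + scale n + 3 * scale n] is at most [3 * scale n.+1],
    because [B] is at least 4. *)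
Lemma spread_near n x T y : spread n x T -> y \in T -> `|y - x| <= 3 * scale n.
Proof.
move=> sT; elim: sT y => {n x T} [x|n x y1 y2 T1 T2 h1 h2 _ _ IH1 _ IH2] y.
  by rewrite inE => /eqP ->; rewrite subrr normr0 mulr_ge0 // ltW // scale_gt0.
have step z : `|z - x| <= 2 * scale n.+1 + scale n -> `|y - z| <= 3 * scale n ->
    `|y - x| <= 3 * scale n.+1.
  by move=> hz hy; have := ler_distD z y x; have := scaleS_ge n; lra.
by rewrite mem_cat => /orP[/IH1|/IH2]; exact: step.
Qed.

Lemma spread_far n y1 y2 T1 T2 p q : scale n.+1 - 2 * scale n <= `|y1 - y2| ->
  spread n y1 T1 -> spread n y2 T2 -> p \in T1 -> q \in T2 ->
  scale n.+1 - 8 * scale n <= `|p - q|.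
Proof.
move=> far s1 s2 pT qT.
have := spread_near _ _ _ _ s1 pT; have := spread_near _ _ _ _ s2 qT.
rewrite [`|p - y1|]distrC; have := ler_distD p y1 y2; have := ler_distD q p y2.
lra.
Qed.

Definition translate n x (z : offset d B) : 'rV[R]_d :=
  x + scale n *: (\row_i ((z i)%:R - (2 * B)%:R)).

(** Each coordinate of [(y - x) / scale n] lies in [[-2B, 2B]]; shifting it by [2 * B] and rounding
    down gives one of [4 * B + 1] naturals, with error below 1. *)
Lemma shift_near n x y : `|y - x| <= 2 * scale n.+1 ->
  exists z, `|y - translate n x z| <= scale n.
Proof.
move=> yx; have sn := scale_gt0 n.
pose v i : R := (y - x) ord0 i / scale n + (2 * B)%:R.
have vi i : 0 <= v i <= (4 * B)%:R.
  have := le_trans (coord_le_norm (y - x) i) yx.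
  rewrite scaleS ler_norml => /andP[h1 h2].
  have g1 : - (2 * B%:R) <= (y - x) ord0 i / scale n by rewrite ler_pdivlMr //; lra.
  have g2 : (y - x) ord0 i / scale n <= 2 * B%:R by rewrite ler_pdivrMr //; lra.
  by rewrite /v !natrM; apply/andP; split; lra.
have vlt i : (Num.truncn (v i) < (4 * B).+1)%N.
  have /andP[v0 v4] := vi i; rewrite ltnS -(ler_nat R).
  by apply: le_trans v4; have /andP[] := truncn_itv v0.
exists [ffun i => Ordinal (vlt i)].
apply: norm_le_coord; first exact: ltW.
move=> i; rewrite rowBE.
have -> : translate n x [ffun i => Ordinal (vlt i)] ord0 i =
    x ord0 i + scale n * ((Num.truncn (v i))%:R - (2 * B)%:R).
  by rewrite /translate !mxE ffunE.
have /andP[v0 _] := vi i; have /andP[] := truncn_itv v0.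
have -> : y ord0 i = x ord0 i + scale n * (v i - (2 * B)%:R).
  by rewrite /v addrK rowBE mulrC divfK ?gt_eqF // addrC subrK.
move: (Num.truncn _) => m; rewrite -natr1 => h1 h2.
by rewrite ler_norml; apply/andP; split; nra.
Qed.

Fixpoint leaves (n : nat) (x : 'rV[R]_d) : tree_code d B n -> seq 'rV[R]_d :=
  match n return tree_code d B n -> seq 'rV[R]_d with
  | 0 => fun _ => [:: x]
  | n'.+1 => fun c =>
      leaves n' (translate n' x c.1.1) c.2.1 ++
      leaves n' (translate n' x c.1.2) c.2.2
  end.

(** The order of [s] and [t] is left free, as crossings both outward and inward occur in the
    recursion. *)
Definition crosses (f : R -> 'rV[R]_d) n x :=
  exists s t, [/\ 0 <= s <= 1, 0 <= t <= 1, `|f s - x| <= scale n & 2 * scale n <= `|f t - x|].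

Lemma crosses_level (f : R -> 'rV[R]_d) n x v :
  {within [set t : R | 0 <= t <= 1], continuous f} ->
  crosses f n x -> scale n <= v <= 2 * scale n ->
  exists2 u, 0 <= u <= 1 & `|f u - x| = v.
Proof.
move=> cf [s [t [s01 t01 fs ft]]] /andP[v1 v2].
have cg : {within [set t : R | 0 <= t <= 1], continuous (fun u => `|f u - x|)}.
  move=> u; apply: (@continuous_comp (subspace [set t : R | 0 <= t <= 1]) _ _ f
    (fun y => `|y - x|)); first exact: cf.
  exact: continuous_dist.
have h01 a b : a <= b -> 0 <= a <= 1 -> 0 <= b <= 1 ->
    {within `[a, b], continuous (fun u => `|f u - x|)}.
  move=> ab /andP[a0 a1] /andP[b0 b1]; apply: continuous_subspaceW cg.
  by move=> u /=; rewrite in_itv /= => /andP[au ub]; apply/andP; split; lra.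
have [st|/ltW ts] := leP s t.
  have [|c] := IVT st (h01 _ _ st s01 t01) (v := v).
    by rewrite ge_min le_max (le_trans fs v1) (le_trans v2 ft) orbT.
  by rewrite in_itv /= => /andP[sc ct] <-; exists c => //; apply/andP; split; lra.
have [|c] := IVT ts (h01 _ _ ts t01 s01) (v := v).
  by rewrite ge_min le_max (le_trans fs v1) (le_trans v2 ft) orbT.
by rewrite in_itv /= => /andP[sc ct] <-; exists c => //; apply/andP; split; lra.
Qed.

Lemma crosses_leaves (f : R -> 'rV[R]_d) n x :
  {within [set t : R | 0 <= t <= 1], continuous f} ->
  crosses f n x -> exists2 c : tree_code d B n, spread n x (leaves n x c) &
    forall y, y \in leaves n x c -> exists2 u, 0 <= u <= 1 & `|f u - y| <= r.
Proof.
move=> cf; elim: n x => [|n IH] x cx.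
  exists tt; first exact: spread_leaf.
  move=> y; rewrite inE => /eqP ->; case: cx => s [t [s01 _ fs _]].
  by exists s => //; rewrite /scale expr0 mulr1 in fs.
have sn := scale_gt0 n; have sS := scaleS_ge n.
have [u1 u1_01 fu1] : exists2 u, 0 <= u <= 1 & `|f u - x| = scale n.+1.
  by apply: crosses_level cf cx _; apply/andP; split; lra.
have [u2 u2_01 fu2] : exists2 u, 0 <= u <= 1 & `|f u - x| = 2 * scale n.+1.
  by apply: crosses_level cf cx _; apply/andP; split; lra.
have [z1 hz1] := shift_near n x (f u1) ltac:(rewrite fu1; lra).
have [z2 hz2] := shift_near n x (f u2) ltac:(rewrite fu2; lra).
case: cx => s [t [s01 t01 fs ft]].
move: hz1 hz2; set y1 := translate n x z1; set y2 := translate n x z2 => hz1 hz2.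
(* [f t] is at least [2 * scale n.+1] from [x] and [y1] at most [scale n.+1 + scale n], which leaves
   more than [2 * scale n]. *)
have c1 : crosses f n y1.
  exists u1, t; split=> //.
  have := ler_distD y1 (f t) x; have := ler_distD (f u1) y1 x.
  by rewrite [`|y1 - f u1|]distrC; lra.
(* Now the centre is near the outer sphere, and the inner point [f s] is the far one. *)
have c2 : crosses f n y2.
  exists u2, s; split=> //.
  have := ler_distD y2 (f u2) x; have := ler_distD (f s) y2 x.
  by rewrite [`|y2 - f s|]distrC; lra.
have [a1 sp1 l1] := IH _ c1; have [a2 sp2 l2] := IH _ c2.
exists ((z1, z2), (a1, a2)); last first.
  by move=> y /=; rewrite mem_cat => /orP[/l1|/l2].
apply: (spread_node n x y1 y2) => //=.
- by have := ler_distD (f u1) y1 x; rewrite [`|y1 - f u1|]distrC; lra.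
- by have := ler_distD (f u2) y2 x; rewrite [`|y2 - f u2|]distrC; lra.
- have := ler_distD y1 (f u2) x; have := ler_distD (f u1) y1 x; have := ler_distD y2 (f u2) y1.
  by rewrite [`|y1 - f u1|]distrC [`|y2 - y1|]distrC; lra.
Qed.

End trees.

(** * The measure of the lines hitting a tree *)

Section spread_measure.
Context {R : realType} {d : nat}.
Variables (nu : set 'M[R]_d -> \bar R) (kappa : set ('rV[R]_d * 'M[R]_d) -> \bar R).
Hypotheses (haar_nu : is_haar_SO d nu) (prod_kappa : is_leb_haar_product d nu kappa).
Variables (r : R) (B : nat).
Hypotheses (d1 : (1 < d)%N) (r0 : 0 < r) (rd : d%:R * r ^+ 2 < 4^-1) (B4 : (4 <= B)%N).
(** The [4 ^ n] pairs of leaves of two sibling trees together cost at most half of the lower bound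
    for a single ball. *)
Hypothesis interaction_small : forall n, exists k,
  2 ^+ k.+1 <= scale r B n.+1 - 8 * scale r B n /\
  4 ^+ n * (perp_vol d (r + 1) * 2 ^- k) <= perp_vol d r / 2.
Implicit Types (T : seq 'rV[R]_d).

Local Notation BK := (borel ('rV[R]_d * 'M[R]_d)%type).

Definition hits_any T : set (set 'rV[R]_d) := \bigcup_(y in [set` T]) hits y.

Lemma gamma_hits_any T :
  gamma @^-1` hits_any T = \big[setU/set0]_(y <- T) (gamma @^-1` hits y).
Proof. by rewrite -bigcup_seq preimage_bigcup. Qed.

Lemma borel_hits_any T : BK (gamma @^-1` hits_any T).
Proof.
rewrite gamma_hits_any; apply: borel_bigU => y.
by apply: borel_open; exact: hits_open.
Qed.

Lemma hits_any_cat T1 T2 :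
  gamma @^-1` hits_any (T1 ++ T2) = gamma @^-1` hits_any T1 `|` gamma @^-1` hits_any T2.
Proof. by rewrite !gamma_hits_any big_cat. Qed.

Lemma kappa_hits_any_lty T : (kappa (gamma @^-1` hits_any T) < +oo)%E.
Proof.
have [mK _ _] := prod_kappa; have [K KE] := measure_of_is_measure _ _ mK.
have [mN _ nT _] := haar_nu.
rewrite -KE; last exact: borel_hits_any.
rewrite gamma_hits_any.
have bh y : BK (gamma @^-1` hits y) by apply: borel_open; exact: hits_open.
apply: le_lt_trans (measure_bigsetU_le K T (fun y => gamma @^-1` hits y)
  (perp_vol d (r + 1))%:E _ bh _) _.
- by rewrite lee_fin perp_vol_ge0 // addr_ge0 // ltW.
- move=> y _; rewrite KE; last exact: bh.
  have := kappa_hits_le nu kappa haar_nu prod_kappa r y setT (ltnW d1) r0 borelT.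
  by rewrite preimage_setT setIT nT mule1.
- by rewrite -EFinM ltry.
Qed.

(** A union bound over the [2 ^ n * 2 ^ n] pairs of one ball from each tree. *)
Lemma kappa_cross_le n k T1 T2 : size T1 = (2 ^ n)%N -> size T2 = (2 ^ n)%N ->
  (forall p q, p \in T1 -> q \in T2 -> 2 ^+ k.+1 <= `|p - q|) ->
  (kappa (gamma @^-1` hits_any T1 `&` gamma @^-1` hits_any T2) <=
     (4 ^+ n * (perp_vol d (r + 1) * 2 ^- k))%:E)%E.
Proof.
move=> s1 s2 far.
have [mK _ _] := prod_kappa; have [K KE] := measure_of_is_measure _ _ mK.
have bh y : BK (gamma @^-1` hits y) by apply: borel_open; exact: hits_open.
pose pairs := [seq (p, q) | p <- T1, q <- T2].
pose G (pq : 'rV[R]_d * 'rV[R]_d) := gamma @^-1` hits pq.1 `&` gamma @^-1` hits pq.2.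
have bG pq : BK (G pq) by exact: borelI.
have bU : BK (\big[setU/set0]_(pq <- pairs) G pq) by exact: borel_bigU.
have bI : BK (gamma @^-1` hits_any T1 `&` gamma @^-1` hits_any T2).
  by apply: borelI; exact: borel_hits_any.
rewrite -KE //; apply: (@le_trans _ _ (K (\big[setU/set0]_(pq <- pairs) G pq))).
  apply: le_measure; rewrite ?inE // -bigcup_seq => z [[p pT hp] [q qT hq]].
  by exists (p, q) => //=; apply/allpairsP; exists (p, q).
have V0 : (0 <= (perp_vol d (r + 1) * 2 ^- k)%:E)%E.
  by rewrite lee_fin mulr_ge0 ?perp_vol_ge0 ?addr_ge0 ?invr_ge0 ?exprn_ge0 // ltW.
apply: le_trans (measure_bigsetU_le K pairs G _ V0 bG _) _.
  move=> pq /allpairsP[[p q] /= [pT qT ->]]; rewrite KE; last exact: bG.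
  have pq0 : 0 < `|p - q| by apply: lt_le_trans (far _ _ pT qT); rewrite exprn_gt0.
  have [i pqi] := norm_attained _ pq0.
  apply: (kappa_hits2_le nu kappa haar_nu prod_kappa r p q i k d1 r0).
  by rewrite -rowBE -pqi; exact: far.
have -> : size pairs = (2 ^ n * 2 ^ n)%N by rewrite size_allpairs s1 s2.
by rewrite -EFinM lee_fin natrM natrX -exprMn -natrM.
Qed.

(** Inclusion-exclusion on the two subtrees: the bounds [a_n = v (2^n + 1) / 2] satisfy [a_0 = v]
    and [a_(n+1) = 2 a_n - v / 2], with [v = perp_vol d r]. *)
Lemma spread_measure_ge n x T : spread r B n x T ->
  ((perp_vol d r * ((2 ^+ n + 1) / 2))%:E <= kappa (gamma @^-1` hits_any T))%E.
Proof.
have [mK _ _] := prod_kappa; have [K KE] := measure_of_is_measure _ _ mK.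
elim=> {n x T} [x|n x y1 y2 T1 T2 _ _ far sp1 IH1 sp2 IH2].
  rewrite expr0 divff // mulr1 gamma_hits_any big_seq1.
  exact: (kappa_hits_ge nu kappa haar_nu prod_kappa r x (ltnW d1) r0 rd).
have [k [kfar kV]] := interaction_small n.
have cross := kappa_cross_le n k T1 T2
  (size_spread _ _ _ _ _ sp1) (size_spread _ _ _ _ _ sp2) _.
have {}cross : (kappa (gamma @^-1` hits_any T1 `&` gamma @^-1` hits_any T2) <=
     (perp_vol d r / 2)%:E)%E.
  apply: (le_trans (cross _)); last by rewrite lee_fin.
  move=> p q pT qT; apply: le_trans kfar _.
  exact: (spread_far r B r0 B4 n y1 y2 T1 T2).
have b1 := borel_hits_any T1; have b2 := borel_hits_any T2.
have bI := borelI _ _ b1 b2.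
have b12 := borel_hits_any (T1 ++ T2).
rewrite hits_any_cat in b12 *.
have f1 := kappa_hits_any_lty T1; have f2 := kappa_hits_any_lty T2.
move: cross IH1 IH2 f1 f2; rewrite -!KE // => cross IH1 IH2 f1 f2.
have fI : (K (gamma @^-1` hits_any T1 `&` gamma @^-1` hits_any T2) < +oo)%E.
  by apply: le_lt_trans cross _; rewrite ltry.
rewrite measureUfinl //; apply: le_trans (leeB (leeD IH1 IH2) cross).
by rewrite -EFinD lee_fin exprS /=; lra.
Qed.

End spread_measure.

(** * Void probabilities and the union bound *)

Lemma exists_exp2_gt {R : realType} (x : R) : exists n, x < 2 ^+ n.
Proof.
exists (Num.truncn `|x|).+1; apply: le_lt_trans (ler_norm x) _.
have /andP[_ h] := truncn_itv (normr_ge0 x); apply: lt_le_trans h _.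
by rewrite -natrX ler_nat ltnW // ltn_expl.
Qed.

Section void_events.
Context {R : realType} {d : nat}.
Implicit Types (x y : 'rV[R]_d) (T : seq 'rV[R]_d).

Lemma sqn_le_norm x : sqn x <= d%:R * `|x| ^+ 2.
Proof.
have -> : d%:R * `|x| ^+ 2 = \sum_(i < d) `|x| ^+ 2.
  by rewrite sumr_const card_ord mulr_natl.
apply: ler_sum => i _.
rewrite -[x _ _ ^+ 2]real_normK ?num_real // lerXn2r ?nnegrE //.
exact: coord_le_norm.
Qed.

Lemma enorm_le1 x : sqn x <= 1 -> enorm x <= 1.
Proof. by move=> h; rewrite -sqrtr1 ler_wsqrtr. Qed.

(** Both [z] and a point of [l] are within Euclidean distance 1/2 of [y], so a line [l] of the
    process would cover [z] by its cylinder. *)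
Lemma vacant_no_hit (om : set 'rV[R]_d -> nat) (r : R) y z (l : set 'rV[R]_d) :
  d%:R * r ^+ 2 < 4^-1 -> `|z - y| <= r -> vacant om z -> hits y l -> om l = 0%N.
Proof.
move=> rd zy vz [q lq qy]; apply/eqP; rewrite -leqn0 leqNgt; apply/negP => oml.
apply: vz; exists l => //; exists q; split=> //; apply: enorm_le1.
have -> : z - q = (z - y) + - (q - y) by rewrite opprB addrA subrK.
apply: le_trans (sqnD_le _ _) _; rewrite sqnN.
have h1 := sqn_le_norm (z - y).
have h2 : d%:R * `|z - y| ^+ 2 <= d%:R * r ^+ 2.
  by rewrite ler_wpM2l // lerXn2r ?nnegrE // (le_trans _ zy).
lra.
Qed.

Lemma connects_crosses (V : set 'rV[R]_d) (r : R) (B n : nat) : (0 < d)%N ->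
  0 < r -> (4 <= B)%N -> connects_to_infinity V ->
  exists f : R -> 'rV[R]_d, [/\ {within [set t : R | 0 <= t <= 1], continuous f},
    crosses r B f n 0 & forall t, 0 <= t <= 1 -> V (f t)].
Proof.
move=> d0 r0 B4 VC; have sn := scale_gt0 r B r0 B4 n.
(* The Euclidean norm is at most [d] times the max-norm, so a path reaching Euclidean distance [N]
   reaches max-norm [2 * scale r B n]. *)
pose N := (Num.truncn (d%:R * (2 * scale r B n))).+1.
have [f [cf f0 f1 fV]] := VC N isT.
exists f; split=> //; exists 0, 1; split; rewrite ?lexx ?ler01 //.
  by rewrite f0 subrr normr0 ltW.
rewrite subr0.
have dR : 0 < (d%:R : R) by rewrite ltr0n.
have x0 : 0 <= d%:R * (2 * scale r B n) by rewrite mulr_ge0 ?mulr_ge0 // ltW.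
have /andP[_ hN] := truncn_itv x0.
have : (N%:R : R) <= d%:R * `|f 1|.
  rewrite -f1 /enorm -/(sqn _) -[leRHS]ger0_norm ?mulr_ge0 // -sqrtr_sqr ler_wsqrtr //.
  apply: le_trans (sqn_le_norm _) _; rewrite exprMn ler_wpM2r ?sqr_ge0 //.
  by rewrite -natrX ler_nat; nia.
by move=> h; rewrite -(ler_pM2l dR) ltW // (lt_le_trans hN).
Qed.

End void_events.

Lemma pois_pmf0 {R : realType} (r : R) : pois_pmf r 0 = expR (- r).
Proof. by rewrite /pois_pmf expr0 mulr1 fact0 divr1. Qed.

Lemma poisson_void {R : realType} {dO : measure_display} {Omega : measurableType dO}
    (P : probability Omega R) {L : choiceType} (om : Omega -> L -> nat)
    (S : set (set L)) (m : set L -> \bar R) (A : set L) :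
  is_poisson_pp P om S m -> S A -> (m A < +oo)%E ->
  measurable [set w | count_pts (R:=R) (om w) A = 0%E] /\
  P [set w | count_pts (R:=R) (om w) A = 0%E] = (expR (- fine (m A)))%:E.
Proof.
move=> pp SA mA.
have [] := pp 1%N (fun=> A) (fun=> 0%N) (fun=> SA) (fun=> mA) _.
  by move=> i j; rewrite (ord1 i) (ord1 j).
have -> : [set w | 'I_1 -> count_pts (R:=R) (om w) A = (0%:R)%:E] =
    [set w | count_pts (R:=R) (om w) A = 0%E].
  by apply/seteqP; split=> w /= h; [exact: (h ord0)|move=> _].
by rewrite big_ord1 pois_pmf0.
Qed.

(** * Covering the connection event by void events *)

Section main.
Context {R : realType} {d : nat}.
Variables (nu : set 'M[R]_d -> \bar R) (kappa : set ('rV[R]_d * 'M[R]_d) -> \bar R).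
Hypotheses (haar_nu : is_haar_SO d nu) (prod_kappa : is_leb_haar_product d nu kappa).
Variables (r : R) (B : nat).
Hypotheses (d1 : (1 < d)%N) (r0 : 0 < r) (rd : d%:R * r ^+ 2 < 4^-1) (B4 : (4 <= B)%N).
Hypothesis interaction_small : forall n, exists k,
  2 ^+ k.+1 <= scale r B n.+1 - 8 * scale r B n /\
  4 ^+ n * (perp_vol d (r + 1) * 2 ^- k) <= perp_vol d r / 2.
Variables (dO : measure_display) (Omega : measurableType dO) (P : probability Omega R).
Variables (om : Omega -> set 'rV[R]_d -> nat) (u : R).
Hypotheses (u0 : 0 < u)
  (pp : is_poisson_pp P om line_measurable (fun A => (u%:E * line_measure kappa A)%E)).

Definition void T : set Omega := [set w | count_pts (R:=R) (om w) (hits_any T) = 0%E].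

Lemma scaled_line_measure_lty T :
  (u%:E * line_measure kappa (hits_any T) < +oo)%E.
Proof.
have := kappa_hits_any_lty _ _ haar_nu prod_kappa _ d1 r0 T.
have : (0 <= kappa (gamma @^-1` hits_any T))%E.
  by have [[_ + _] _ _] := prod_kappa; apply; exact: borel_hits_any.
by rewrite /line_measure; case: (kappa _) => // a _ _; rewrite -EFinM ltry.
Qed.

Lemma measurable_void T : measurable (void T).
Proof.
by have [] := poisson_void P om _ _ (hits_any T) pp (borel_hits_any T)
  (scaled_line_measure_lty T).
Qed.

(** The exponent is [u] times the measure of the lines hitting [T]; weakening [(2 ^ n + 1) / 2] to
    [2 ^ n / 2] leaves a pure power. *)
Lemma void_le n T : spread r B n 0 T ->
  (P (void T) <= (expR (- (u * (perp_vol d r / 2))) ^+ (2 ^ n))%:E)%E.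
Proof.
move=> sp.
have lty := kappa_hits_any_lty _ _ haar_nu prod_kappa _ d1 r0 T.
have ge := spread_measure_ge _ _ haar_nu prod_kappa _ _ d1 r0 rd B4 interaction_small _ _ _ sp.
have [_ ->] := poisson_void P om _ _ (hits_any T) pp (borel_hits_any T)
  (scaled_line_measure_lty T).
rewrite lee_fin -expRM_natl ler_expR /line_measure.
case: (kappa _) lty ge => // a _; rewrite lee_fin => ha.
rewrite -EFinM /= mulrN lerN2 mulrCA ler_pM2l // natrX.
have := perp_vol_ge0 d r (ltW r0); nra.
Qed.

(** A measurable event covering the connection event, whose own measurability is not claimed. *)
Definition blocked n : set Omega :=
  \big[setU/set0]_(c : tree_code d B n | `[< spread r B n 0 (leaves r B n 0 c) >])
    void (leaves r B n 0 c).

Lemma connects_blocked n :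
  [set w | connects_to_infinity (vacant (om w))] `<=` blocked n.
Proof.
move=> w /= /(connects_crosses _ r B n (ltnW d1) r0 B4)[f [cf cx fV]].
have [c sp hc] := crosses_leaves r B r0 B4 f n 0 cf cx.
rewrite /blocked -bigcup_seq_cond; exists c => /=.
  by rewrite mem_index_enum; apply/asboolP.
rewrite /void /= /count_pts esum1 // => l [y yT hy].
have [t t01 ty] := hc y yT.
by rewrite (vacant_no_hit (om w) r y (f t) l rd ty (fV t t01) hy).
Qed.

Lemma measurable_blocked n : measurable (blocked n).
Proof. by apply: bigsetU_measurable => c _; exact: measurable_void. Qed.

Lemma blocked_le n :
  (#|offset d B| ^ 2)%:R * expR (- (u * (perp_vol d r / 2))) <= 2^-1 ->
  (P (blocked n) <= (2 ^- n)%:E)%E.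
Proof.
set K := (_ ^ 2)%N; set e := expR _ => Ke.
have e0 : 0 <= e by exact: expR_ge0.
have K0 : (0 < K)%N by rewrite expn_gt0 card_ffun expn_gt0 card_ord.
(* The union bound is at most [(K * e) ^ (2 ^ n)], where [K * e] is at most 1/2, and [2 ^ n] exceeds
   [n]. *)
have codeK : (#|tree_code d B n|%:R : R) <= K%:R ^+ (2 ^ n).
  rewrite -natrX ler_nat -card_tree_code leq_pmulr //.
apply: (@le_trans _ _ ((#|tree_code d B n|%:R * e ^+ (2 ^ n))%:E)).
  rewrite /blocked -big_filter EFinM.
  apply: le_trans (measure_bigsetU_le P _ _ (e ^+ (2 ^ n))%:E _ _ _) _.
  - by rewrite lee_fin exprn_ge0.
  - by move=> c; exact: measurable_void.
  - by move=> c; rewrite mem_filter => /andP[/asboolP sp _]; exact: void_le.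
  rewrite -!EFinM lee_fin ler_wpM2r ?exprn_ge0 // ler_nat.
  by rewrite -sum1_size big_filter sum1_card max_card.
rewrite lee_fin; apply: (@le_trans _ _ ((K%:R * e) ^+ (2 ^ n))).
  by rewrite exprMn ler_wpM2r // exprn_ge0.
apply: (@le_trans _ _ (2^-1 ^+ (2 ^ n))).
  by rewrite lerXn2r ?nnegrE ?mulr_ge0 // invr_ge0.
rewrite -exprVn ler_wiXn2l ?invr_ge0 ?invf_le1 ?ler1n //.
by rewrite ltnW // ltn_expl.
Qed.

(** The intersection of all [blocked n] is the null set required: its probability is at most
    [2 ^- n] for every [n]. *)
Lemma connects_negligible :
  (#|offset d B| ^ 2)%:R * expR (- (u * (perp_vol d r / 2))) <= 2^-1 ->
  P.-negligible [set w | connects_to_infinity (vacant (om w))].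
Proof.
move=> Ke; exists (\bigcap_n blocked n); split.
- by apply: bigcap_measurable => // n _; exact: measurable_blocked.
- have mcap : measurable (\bigcap_n blocked n).
    by apply: bigcap_measurable => // n _; exact: measurable_blocked.
  apply/eqP; rewrite eq_le measure_ge0 andbT leNgt; apply/negP => P0.
  have le n : (P (\bigcap_n blocked n) <= (2 ^- n)%:E)%E.
    apply: le_trans (blocked_le n Ke); apply: le_measure; rewrite ?inE //.
      exact: measurable_blocked.
    exact: bigcap_inf.
  case: (P _) P0 le => [p||] // => [p0 le|_ /(_ 0%N)//].
  have [n hn] := exists_exp2_gt p^-1.
  have := le n; rewrite lee_fin leNgt => /negP; apply.
  by rewrite -[ltRHS]invrK ltf_pV2 // posrE ?invr_gt0 ?exprn_gt0.
- by move=> w hw n _; exact: connects_blocked.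
Qed.

End main.

(** * Choice of the scale ratio and of the constant *)

Lemma interaction_scale {R : realType} (d : nat) (r V m : R) : 0 < r -> 0 <= V -> 0 < m ->
  exists2 B, (4 <= B)%N & forall n, exists k,
    2 ^+ k.+1 <= scale r B n.+1 - 8 * scale r B n /\ 4 ^+ n * (V * 2 ^- k) <= m / 2.
Proof.
move=> r0 V0 m0.
have [C hC] := exists_exp2_gt (2 * V / m).
have [D hD] := exists_exp2_gt (2 ^+ C.+1 / r).
(* This gives [(B - 8) * r >= 2 ^ C.+1], which handles the gap [(B - 8) * scale r B n] between
   sibling trees. *)
exists (16 + 2 ^ D)%N; first by [].
(* The part [2 * n] cancels the [4 ^ n] pairs, and [C] makes [V / 2 ^ C] at most [m / 2]. *)
move=> n; exists (2 * n + C)%N.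
have pow4 : (2 : R) ^+ (2 * n) = 4 ^+ n.
  by rewrite exprM; congr (_ ^+ _); rewrite expr2; lra.
have p4 : 0 < (4 : R) ^+ n by exact: exprn_gt0.
have p2 : 0 < (2 : R) ^+ C by exact: exprn_gt0.
split; last first.
  have -> : 4 ^+ n * (V * 2 ^- (2 * n + C)) = V / 2 ^+ C.
    by rewrite exprD pow4; field; rewrite !gt_eqF.
  by move: hC; rewrite ltr_pdivrMr // ler_pdivrMr // => hC; lra.
have -> : (2 : R) ^+ (2 * n + C).+1 = 2 ^+ C.+1 * 4 ^+ n.
  by rewrite -pow4 -exprD addnC -addSn.
have D0 : 0 < (2 : R) ^+ D by exact: exprn_gt0.
have hB : 2 ^+ C.+1 <= ((16 + 2 ^ D)%:R - 8) * r.
  by move: hD; rewrite ltr_pdivrMr // natrD natrX; nra.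
have h4 : (4 : R) ^+ n <= (16 + 2 ^ D)%:R ^+ n.
  by rewrite lerXn2r ?nnegrE // natrD natrX; lra.
rewrite scaleS -mulrBl /scale mulrA; by apply: ler_pM => //; rewrite exprn_ge0.
Qed.

Theorem theorem4p1 (R : realType) (d : nat) : (3 <= d)%N ->
  exists c : R, 0 < c /\
  forall u : R, c <= u ->
  forall (nu : set 'M[R]_d -> \bar R)
         (kappa : set ('rV[R]_d * 'M[R]_d) -> \bar R),
    is_haar_SO d nu -> is_leb_haar_product d nu kappa ->
  forall (dO : measure_display) (Omega : measurableType dO)
         (P : probability Omega R) (om : Omega -> set 'rV[R]_d -> nat),
    is_poisson_pp P om line_measurable
      (fun A => (u%:E * line_measure kappa A)%E) ->
    P.-negligible [set w | connects_to_infinity (vacant (om w))].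
Proof.
move=> d3; have d1 : (1 < d)%N by exact: ltn_trans d3.
have dR : 1 < (d%:R : R) by rewrite ltr1n.
(* With this radius [d * r^2] equals [1 / (4 d)], below 1/4. *)
pose r : R := (2 * d%:R)^-1.
have r0 : 0 < r by rewrite invr_gt0; lra.
have rd : d%:R * r ^+ 2 < 4^-1.
  have -> : d%:R * r ^+ 2 = 4^-1 * d%:R^-1 by rewrite /r; field; lra.
  by rewrite gtr_pMr ?invr_gt0 // invf_lt1 //; lra.
have m0 := perp_vol_gt0 d r r0.
have V0 : 0 <= perp_vol d (r + 1) by apply: perp_vol_ge0; lra.
have [B B4 small] := interaction_scale d r _ _ r0 V0 m0.
pose K : R := (#|offset d B| ^ 2)%:R.
have K0 : 0 < K by rewrite ltr0n expn_gt0 card_ffun expn_gt0 card_ord.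
pose a := perp_vol d r / 2.
have a0 : 0 < a by rewrite divr_gt0.
(* For such [u], [expR (u * a) >= 1 + u * a >= 2 * K], so [K * expR (- (u * a))] is at most 1/2. *)
exists (2 * K / a); split; first by rewrite divr_gt0 // mulr_gt0.
move=> u cu nu kappa haar_nu prod_kappa dO Omega P om pp.
have u0 : 0 < u by apply: lt_le_trans cu; rewrite divr_gt0 // mulr_gt0.
apply: (connects_negligible nu kappa haar_nu prod_kappa r B d1 r0 rd B4 small
  dO Omega P om u u0 pp).
rewrite -/K -/a expRN -ler_pdivlMr ?invr_gt0 ?expR_gt0 // invrK.
rewrite mulrC -ler_pdivrMr ?invr_gt0 // invrK mulrC.
apply: le_trans (expR_ge1Dx _).
by move: cu; rewrite ler_pdivrMr // => cu; lra.
Qed.
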